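(* Let $S\subseteq\mathbb{R}^d$ be nonempty, compact and convex, and fix a realized cost vector $c\in\mathbb{R}^d$. Then: 1. $\ell_{\mathrm{SPO}}(\hat c,c)\le \ell_{\mathrm{SPO+}}(\hat c,c)$ for all $\hat c\in\mathbb{R}^d$; 2. $\ell_{\mathrm{SPO+}}(\hat c,c)$ is a convex function of $\hat c\in\mathbb{R}^d$; 3. for any given $\hat c\in\mathbb{R}^d$, $2(w^*(c)-w^*(2\hat c-c))$ is a subgradient of $\ell_{\mathrm{SPO+}}(\cdot,c)$ at $\hat c$, i.e., $2(w^*(c)-w^*(2\hat c-c))\in\partial\ell_{\mathrm{SPO+}}(\hat c,c)$.
   Context: For $c\in\mathbb{R}^d$: $z^*(c) := \min_{w\in S} c^Tw$, $W^*(c) := \arg\min_{w\in S} c^Tw$, and $w^*(\cdot):\mathbb{R}^d\to S$ is a fixed oracle, i.e., an arbitrary fixed mapping with $w^*(c)\in W^*(c)$ for all $c$. The (unambiguous) SPO loss is $\ell_{\mathrm{SPO}}(\hat c,c) := \max_{w\in W^*(\hat c)} c^Tw - z^*(c)$. The SPO+ loss is $\ell_{\mathrm{SPO+}}(\hat c,c) := \max_{w\in S}\{c^Tw-2\hat c^Tw\}+2\hat c^Tw^*(c)-z^*(c)$. The subdifferential $\partial\ell_{\mathrm{SPO+}}(\hat c,c)$ is with respect to the first argument. *)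

(* Defs.v *)
From HB Require Import structures.
From mathcomp Require Import all_boot all_order all_algebra.
From mathcomp Require Import all_classical all_reals all_analysis.

Set Implicit Arguments.
Unset Strict Implicit.
Unset Printing Implicit Defensive.

Import Order.TTheory GRing.Theory Num.Theory.
Import numFieldNormedType.Exports.

Local Open Scope classical_set_scope.
Local Open Scope ring_scope.

Definition dotp (R : realType) (d : nat) (u v : 'cV[R]_d) : R :=
  (u^T *m v) 0 0.

(* Attained extrema: the value is an element of the image [f @` A] bounding
   all of it. When no such element exists the value is the junk value 0. *)
Definition max_over (R : realType) (T : Type) (A : set T) (f : T -> R) : R :=
  xget 0 ((f @` A) `&` ubound (f @` A)).

Definition min_over (R : realType) (T : Type) (A : set T) (f : T -> R) : R :=
  xget 0 ((f @` A) `&` lbound (f @` A)).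

Definition argmin (R : realType) (T : Type) (A : set T) (f : T -> R) : set T :=
  [set w | A w /\ forall v, A v -> f w <= f v].

Section SPO.
Variables (R : realType) (d : nat) (S : set 'cV[R]_d).
Implicit Types c chat : 'cV[R]_d.

Definition zstar c : R := min_over S (dotp c).

Definition Wstar c : set 'cV[R]_d := argmin S (dotp c).

Definition is_oracle (wstar : 'cV[R]_d -> 'cV[R]_d) : Prop :=
  forall c, Wstar c (wstar c).

Definition spo_loss chat c : R :=
  max_over (Wstar chat) (dotp c) - zstar c.

Definition spo_plus_loss (wstar : 'cV[R]_d -> 'cV[R]_d) chat c : R :=
  max_over S (fun w => dotp c w - 2 * dotp chat w)
  + 2 * dotp chat (wstar c) - zstar c.

End SPO.

Definition subdifferential (R : realType) (d : nat) (f : 'cV[R]_d -> R)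
    (x : 'cV[R]_d) : set 'cV[R]_d :=
  [set g | forall y, f x + dotp g (y - x) <= f y].

(* Main.v *)
(* The maximum defining the SPO+ loss is that of [w |-> (c - 2 chat)^T w],
   which the oracle attains at [wstar (2 chat - c)].  For fixed maximizer the
   loss is affine in [chat], which yields the subgradient, and a function with
   a subgradient everywhere is convex.  For the comparison of the two losses, a
   minimizer [w] of [chat] satisfies [chat^T w <= chat^T wstar c], so
   [c^T w <= (c^T w - 2 chat^T w) + 2 chat^T wstar c]. *)
Require Import Defs.
From HB Require Import structures.
From mathcomp Require Import all_boot all_order all_algebra.
From mathcomp Require Import all_classical all_reals all_analysis.
From mathcomp Require Import ring lra.
Set Implicit Arguments.
Unset Strict Implicit.

Import Order.TTheory GRing.Theory Num.Theory.
Import numFieldNormedType.Exports.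
Local Open Scope classical_set_scope.
Local Open Scope ring_scope.

Lemma dotpE (R : realType) (d : nat) (u v : 'cV[R]_d) :
  dotp u v = \sum_i u i 0 * v i 0.
Proof. by rewrite /dotp mxE; apply: eq_bigr => i _; rewrite mxE. Qed.

Lemma dotpC (R : realType) (d : nat) (u v : 'cV[R]_d) : dotp u v = dotp v u.
Proof. by rewrite !dotpE; apply: eq_bigr => i _; rewrite mulrC. Qed.

Lemma dotpDr (R : realType) (d : nat) (u v w : 'cV[R]_d) :
  dotp u (v + w) = dotp u v + dotp u w.
Proof. by rewrite /dotp mulmxDr mxE. Qed.

Lemma dotpZr (R : realType) (d : nat) (a : R) (u v : 'cV[R]_d) :
  dotp u (a *: v) = a * dotp u v.
Proof. by rewrite /dotp -scalemxAr mxE. Qed.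

Lemma dotpBr (R : realType) (d : nat) (u v w : 'cV[R]_d) :
  dotp u (v - w) = dotp u v - dotp u w.
Proof. by rewrite dotpDr -scaleN1r dotpZr mulN1r. Qed.

Lemma dotpZl (R : realType) (d : nat) (a : R) (u v : 'cV[R]_d) :
  dotp (a *: u) v = a * dotp u v.
Proof. by rewrite dotpC dotpZr dotpC. Qed.

Lemma dotpBl (R : realType) (d : nat) (u v w : 'cV[R]_d) :
  dotp (u - v) w = dotp u w - dotp v w.
Proof. by rewrite dotpC dotpBr !(dotpC w). Qed.

Lemma dotp_continuous (R : realType) (d : nat) (u : 'cV[R]_d) :
  continuous (dotp u).
Proof.
rewrite (_ : dotp u = fun v => \sum_i u i 0 * v i 0); last first.
  by apply/funext => v; exact: dotpE.
apply: continuous_big => [|i _ x]; first exact: add_continuous.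
exact: cvgMl_tmp (@coord_continuous R d 1 i 0 x).
Qed.

(** Two attained upper bounds of the same image are equal by antisymmetry, so the choice made by
    [xget] is forced; the witness [w] excludes the default 0. *)
Lemma max_over_eq (R : realType) (T : Type) (A : set T) (f : T -> R) (w : T) :
  A w -> (forall v, A v -> f v <= f w) -> max_over A f = f w.
Proof.
move=> Aw fw; rewrite /max_over; case: xgetP => [_ -> [[v Av <-] ub]|no_max].
  by apply/le_anti/andP; split; [exact: fw|apply: ub; exists w].
case: (no_max (f w)); split; first by exists w.
by move=> _ [v Av <-]; exact: fw.
Qed.

(** Once some minimizer [w] exists, the minimizers are the points of [A] in the closed sublevel set
    of [f] at height [f w]. This compactness makes the maximum in the SPO loss attained. *)
Lemma argmin_compact (R : realType) (T : topologicalType) (A : set T)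
    (f : T -> R) :
  compact A -> continuous f -> compact (argmin A f).
Proof.
move=> cA cf; have [->|/set0P [w [Aw wmin]]] := eqVneq (argmin A f) set0.
  exact: compact0.
have -> : argmin A f = A `&` f @^-1` [set r | r <= f w].
  apply/seteqP; split=> v [Av /= fv]; split=> //; first exact: fv.
  by move=> u Au; apply: le_trans fv (wmin u Au).
apply: compact_closedI => //.
by move/continuous_closedP : cf; apply; exact: closed_le.
Qed.

(** Average, with weights [t] and [1 - t], the subgradient inequalities at the intermediate point
    [m]: the linear terms cancel because [m] is the same average of [x] and [y]. *)
Lemma subgradient_convex (R : realType) (d : nat) (f : 'cV[R]_d -> R) :
  (forall x, subdifferential f x !=set0) ->
  convex_function ([set: 'cV[R]_d] : set (convex_lmodType 'cV[R]_d)) f.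
Proof.
move=> subf t x y _ _; rewrite convRE.
have -> : conv t x y = t%:num *: (x : 'cV[R]_d) + (1 - t%:num) *: (y : 'cV[R]_d).
  by [].
set m := _ + _; have [g gm] := subf m.
have t0 : 0 <= t%:num by [].
have t1 : 0 <= 1 - t%:num by rewrite subr_ge0.
have := lerD (ler_wpM2l t0 (gm x)) (ler_wpM2l t1 (gm y)).
(* What remains is an equality: the averaged left-hand side is exactly [f m]. *)
apply: le_trans; rewrite !dotpBr dotpDr !dotpZr le_eqVlt.
by apply/orP; left; apply/eqP; ring.
Qed.

Lemma spo_plus_lossE (R : realType) (d : nat) (S : set 'cV[R]_d)
    (wstar : 'cV[R]_d -> 'cV[R]_d) (chat c : 'cV[R]_d) (w : 'cV[R]_d) :
  Wstar S (2 *: chat - c) w ->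
  spo_plus_loss S wstar chat c =
    dotp c w - 2 * dotp chat w + 2 * dotp chat (wstar c) - zstar S c.
Proof.
move=> [Sw wmin]; rewrite /spo_plus_loss (max_over_eq (w := w))// => v Sv.
by have := wmin v Sv; rewrite !dotpBl !dotpZl; lra.
Qed.

(** The oracle point for [2 *: chat - c] attains the maximum, so every feasible [w] is a competitor.
    Both the loss comparison and the subgradient inequality come from a choice of [w]. *)
Lemma spo_plus_loss_ge (R : realType) (d : nat) (S : set 'cV[R]_d)
    (wstar : 'cV[R]_d -> 'cV[R]_d) (wstar_oracle : is_oracle S wstar)
    (chat c w : 'cV[R]_d) :
  S w ->
  dotp c w - 2 * dotp chat w + 2 * dotp chat (wstar c) - zstar S c
    <= spo_plus_loss S wstar chat c.
Proof.
move=> Sw; have Ww := wstar_oracle (2 *: chat - c).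
rewrite (spo_plus_lossE _ Ww); have := Ww.2 w Sw.
by rewrite !dotpBl !dotpZl; lra.
Qed.

Lemma spo_plus_subgradient (R : realType) (d : nat) (S : set 'cV[R]_d)
    (wstar : 'cV[R]_d -> 'cV[R]_d) (wstar_oracle : is_oracle S wstar)
    (c chat : 'cV[R]_d) :
  subdifferential (fun b => spo_plus_loss S wstar b c) chat
    (2 *: (wstar c - wstar (2 *: chat - c))).
Proof.
move=> y; have Ww := wstar_oracle (2 *: chat - c).
(* The maximizer for [chat] is kept as competitor at [y]; this bound minus the exact value at [chat]
   is linear in [y - chat]. *)
have := spo_plus_loss_ge wstar_oracle y c Ww.1; rewrite (spo_plus_lossE _ Ww).
by rewrite dotpZl dotpBr !dotpBl !(dotpC (wstar _)); lra.
Qed.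

Theorem proposition3 (R : realType) (d : nat) (S : set 'cV[R]_d)
    (S_nonempty : S !=set0) (S_compact : compact S)
    (S_convex : convex_set (S : set (convex_lmodType 'cV[R]_d)))
    (wstar : 'cV[R]_d -> 'cV[R]_d) (wstar_oracle : is_oracle S wstar)
    (c : 'cV[R]_d) :
  [/\ forall chat : 'cV[R]_d, spo_loss S chat c <= spo_plus_loss S wstar chat c,
      convex_function
        ([set: 'cV[R]_d] : set (convex_lmodType 'cV[R]_d))
        (fun chat : 'cV[R]_d => spo_plus_loss S wstar chat c)
    & forall chat : 'cV[R]_d,
        subdifferential (fun b : 'cV[R]_d => spo_plus_loss S wstar b c) chat
          (2 *: (wstar c - wstar (2 *: chat - c)))].
Proof.
split=> [chat||chat]; last exact: spo_plus_subgradient.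
(* The extreme value theorem on the compact set [Wstar S chat], nonempty thanks to the oracle, shows
   that the SPO loss uses a true maximum. *)
- have [w /set_mem Ww wmax] : exists2 w, w \in Wstar S chat &
      forall v, v \in Wstar S chat -> dotp c v <= dotp c w.
    apply: compact_EVT_max; first by exists (wstar chat).
      by apply: argmin_compact => //; exact: dotp_continuous.
    by apply: continuous_subspaceT; exact: dotp_continuous.
  rewrite /spo_loss (max_over_eq (w := w))// => [|v Wv]; last first.
    by apply: wmax; exact/mem_set.
  apply: le_trans (spo_plus_loss_ge wstar_oracle chat c Ww.1).
  (* Testing the minimality of [w] for [chat] against the feasible point [wstar c] gives the sign of
     the extra terms. *)
  have := Ww.2 _ (wstar_oracle c).1; lra.
- apply: subgradient_convex => x; eexists; exact: spo_plus_subgradient.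
Qed.
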